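(* Let $\beta,\gamma\in[0,2)$ with $\beta+\gamma<2$, let $T_n^{\beta,\gamma}(x)=\cos\left(\frac{2n}{2-\beta-\gamma}\left(\arccos x-\frac{\gamma\pi}{2}\right)\right)$ for $n\ge0$, $x\in[-1,1]$, and let $\widehat T_n^{\beta,\gamma}=2^{1-n}T_n^{\beta,\gamma}$ for $n\ge1$ and $\widehat T_0^{\beta,\gamma}=1$. Let $\lambda_1\neq0$ be a real number, $\lambda_2=\frac12$ and $\lambda_n=\frac14$ for $n\ge3$. Then for every $x\in[-1,1]$ and every integer $n\ge1$, the $n$-th partial denominator $B_n(x)$ of the continued fraction $$\cfrac{\lambda_1}{T_1^{\beta,\gamma}(x)-\cfrac{\lambda_2}{T_1^{\beta,\gamma}(x)-\cfrac{\lambda_3}{T_1^{\beta,\gamma}(x)-\cdots}}}$$ satisfies $B_n(x)=\widehat T_n^{\beta,\gamma}(x)$.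
   Context: The $n$-th partial fraction of the continued fraction is the finite continued fraction obtained by keeping only the terms with $\lambda_1,\dots,\lambda_n$. Its (canonical) partial numerator $A_n$ and partial denominator $B_n$, whose quotient $A_n/B_n$ is the value of the $n$-th partial fraction, are those given by the fundamental recurrences $$B_n=T_1^{\beta,\gamma}(x)B_{n-1}-\lambda_nB_{n-2}\ (n\ge1),\quad B_{-1}=0,\ B_0=1,$$ $$A_n=T_1^{\beta,\gamma}(x)A_{n-1}-\lambda_nA_{n-2}\ (n\ge2),\quad A_{-1}=1,\ A_0=0,\ A_1=\lambda_1.$$ *)

(* Defs.v *)
From HB Require Import structures.
From mathcomp Require Import all_boot all_order all_algebra.
From mathcomp Require Import reals trigo.
From mathcomp Require Import ring.

Set Implicit Arguments.
Unset Strict Implicit.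
Unset Printing Implicit Defensive.

Import Order.TTheory GRing.Theory Num.Theory.

Local Open Scope ring_scope.

Definition chebT (R : realType) (beta gamma : R) (n : nat) (x : R) : R :=
  cos ((2 * n%:R) / (2 - beta - gamma) * (acos x - gamma * pi / 2)).

(* The exponent 1 - n is an integer, so that this is 2^(1-n) T_n for n >= 1. *)
Definition chebT_hat (R : realType) (beta gamma : R) (n : nat) (x : R) : R :=
  if n is 0%N then 1 else 2 ^ (1 - n%:Z) * chebT beta gamma n x.

(* Everything below concerns the continued fraction
     lam 1 / (t - lam 2 / (t - lam 3 / (t - ...)));
   the value lam 0 is never used. *)

(* lam k / (t - lam k.+1 / (t - ... / (t - lam (k + m - 1) / (t - w)))),
   which is w when m = 0. *)
Fixpoint cf_nest (R : fieldType) (t : R) (lam : nat -> R) (k m : nat) (w : R)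
    : R :=
  if m is m'.+1 then lam k / (t - cf_nest t lam k.+1 m' w) else w.

Definition cf_partial_fraction (R : fieldType) (t : R) (lam : nat -> R)
    (n : nat) : R :=
  cf_nest t lam 1 n 0.

(* Indices start at -1 in the recurrence: cf_den_from t lam k is B_(k - 1). *)
Fixpoint cf_den_from (R : fieldType) (t : R) (lam : nat -> R) (k : nat) : R :=
  match k with
  | 0%N => 0
  | 1%N => 1
  | (n.+1 as k').+1 => t * cf_den_from t lam k' - lam k' * cf_den_from t lam n
  end.

Definition cf_den (R : fieldType) (t : R) (lam : nat -> R) (n : nat) : R :=
  cf_den_from t lam n.+1.

(* cf_num t lam n is A_n. The recurrence starts at n = 2, so that A_(-1) = 1
   does not enter into it. *)
Fixpoint cf_num (R : fieldType) (t : R) (lam : nat -> R) (n : nat) : R :=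
  match n with
  | 0%N => 0
  | 1%N => lam 1%N
  | (m.+1 as n').+1 => t * cf_num t lam n' - lam n * cf_num t lam m
  end.

Lemma cf_den0 (R : fieldType) (t : R) (lam : nat -> R) : cf_den t lam 0 = 1.
Proof. by []. Qed.

Lemma cf_den1 (R : fieldType) (t : R) (lam : nat -> R) :
  cf_den t lam 1 = t * cf_den t lam 0 - lam 1%N * 0.
Proof. by []. Qed.

Lemma cf_denSS (R : fieldType) (t : R) (lam : nat -> R) (n : nat) :
  cf_den t lam n.+2 = t * cf_den t lam n.+1 - lam n.+2 * cf_den t lam n.
Proof. by []. Qed.

Lemma cf_numSS (R : fieldType) (t : R) (lam : nat -> R) (n : nat) :
  cf_num t lam n.+2 = t * cf_num t lam n.+1 - lam n.+2 * cf_num t lam n.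
Proof. by []. Qed.

Lemma cf_nest_last (R : fieldType) (t : R) (lam : nat -> R) (k m : nat)
    (w : R) :
  cf_nest t lam k m.+1 w = cf_nest t lam k m (lam (k + m)%N / (t - w)).
Proof.
elim: m k => [|m IHm] k; first by rewrite addn0.
by rewrite -[LHS]/(lam k / (t - cf_nest t lam k.+1 m.+1 w)) IHm /= addSnnS.
Qed.

Lemma cf_nestE (R : fieldType) (t : R) (lam : nat -> R) (n : nat) (w : R) :
  (forall k, (1 < k <= n.+1)%N -> t - cf_nest t lam k.+1 (n.+1 - k) w != 0) ->
  cf_nest t lam 1 n.+1 w =
  (cf_num t lam n.+1 - w * cf_num t lam n) /
  (cf_den t lam n.+1 - w * cf_den t lam n).
Proof.
elim: n w => [|n IHn] w nz.
  by rewrite /cf_den /= !mulr0 !mulr1 !subr0.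
have tw : t - w != 0.
  by have := nz n.+2; rewrite subnn /= ltnSn; apply.
rewrite cf_nest_last IHn; last first.
  move=> k /andP[k1 kn]; have := nz k.
  rewrite k1 (leq_trans kn) // subSn // cf_nest_last => /(_ isT).
  by rewrite addSnnS -subSn // subnKC // ltnW.
rewrite add1n cf_denSS cf_numSS.
set a := cf_num _ _ _; set b := cf_num _ _ _.
set c := cf_den _ _ _; set d := cf_den _ _ _; set l := lam _.
have E u v : u - l / (t - w) * v = (t * u - l * v - w * u) / (t - w) by field.
by rewrite !E invfM invrK mulrACA mulVf // mulr1.
Qed.

Lemma cf_partial_fractionE (R : fieldType) (t : R) (lam : nat -> R) (n : nat) :
  (forall k, (1 < k <= n)%N -> t - cf_nest t lam k.+1 (n - k) 0 != 0) ->
  cf_partial_fraction t lam n = cf_num t lam n / cf_den t lam n.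
Proof.
case: n => [|n] nz; first by rewrite mul0r.
by rewrite /cf_partial_fraction cf_nestE // !mul0r !subr0.
Qed.

(* Main.v *)
Require Import Defs.
From mathcomp Require Import all_boot all_order all_algebra.
From mathcomp Require Import reals trigo.
From mathcomp Require Import ring.

Import Order.TTheory GRing.Theory Num.Theory.

Local Open Scope ring_scope.

(** For fixed [x], [chebT beta gamma n x] is [cos (n * theta)] for one angle
    [theta] that does not depend on [n].  The addition formula for the cosine
    hence gives the Chebyshev recurrence [T_(n+2) = 2 T_1 T_(n+1) - T_n]
    ([chebTSS]).  Dividing by [2 ^ (n + 1)], the scaled functions satisfy
    [That_(n+2) = T_1 That_(n+1) - That_n / 4] for [n >= 1], while
    [That_2 = T_1 That_1 - 1 / 2], the coefficient being doubled since
    [That_0 = T_0 = 1] is half of [2 ^ (1 - 0) T_0].  This is the recurrence of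
    the partial denominators, with the same values at [0] and [1]. *)

Lemma cos_mulrnSS (R : realType) (a : R) (n : nat) :
  cos (n.+2%:R * a) = 2 * cos a * cos (n.+1%:R * a) - cos (n%:R * a).
Proof.
have -> : n.+2%:R * a = n.+1%:R * a + a by rewrite -natr1 mulrDl mul1r.
have -> : n%:R * a = n.+1%:R * a - a by rewrite -natr1 mulrDl mul1r addrK.
by rewrite cosD cosB; ring.
Qed.

Lemma chebTE (R : realType) (beta gamma : R) (n : nat) (x : R) :
  chebT beta gamma n x =
  cos (n%:R * (2 / (2 - beta - gamma) * (acos x - gamma * pi / 2))).
Proof. by rewrite /chebT mulrA; congr (cos (_ * _)); rewrite mulrA [2 * _]mulrC. Qed.

Lemma chebT0 (R : realType) (beta gamma x : R) : chebT beta gamma 0 x = 1.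
Proof. by rewrite chebTE mul0r cos0. Qed.

Lemma chebTSS (R : realType) (beta gamma : R) (n : nat) (x : R) :
  chebT beta gamma n.+2 x =
  2 * chebT beta gamma 1 x * chebT beta gamma n.+1 x - chebT beta gamma n x.
Proof. by rewrite !chebTE cos_mulrnSS mul1r. Qed.

Lemma chebT_hatS (R : realType) (beta gamma : R) (n : nat) (x : R) :
  chebT_hat beta gamma n.+1 x = 2^-1 ^+ n * chebT beta gamma n.+1 x.
Proof. by rewrite /chebT_hat intS opprD addrA subrr add0r -exprnN exprVn. Qed.

Theorem mainTheorem5 (R : realType) (beta gamma : R) (lam : nat -> R) :
  0 <= beta < 2 -> 0 <= gamma < 2 -> beta + gamma < 2 ->
  lam 1%N != 0 -> lam 2%N = 1 / 2 ->
  (forall n : nat, (3 <= n)%N -> lam n = 1 / 4) ->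
  forall (x : R) (n : nat), -1 <= x <= 1 -> (1 <= n)%N ->
    cf_den (chebT beta gamma 1 x) lam n = chebT_hat beta gamma n x.
Proof.
move=> _ _ _ _ lam2 lam3 x [//|n] _ _.
set t := chebT beta gamma 1 x.
have B1 : cf_den t lam 1 = chebT_hat beta gamma 1 x.
  by rewrite cf_den1 cf_den0 mulr0 subr0 mulr1 chebT_hatS expr0 mul1r.
(* The recurrence has order two, so the induction carries two consecutive
   equalities. *)
suff [] : cf_den t lam n.+1 = chebT_hat beta gamma n.+1 x /\
          cf_den t lam n.+2 = chebT_hat beta gamma n.+2 x by [].
elim: n => [|n [IH1 IH2]]; split=> //.
  rewrite cf_denSS cf_den0 B1 lam2 !chebT_hatS chebTSS chebT0 -/t.
  by field.
rewrite cf_denSS IH1 IH2 lam3 // !chebT_hatS [chebT _ _ n.+3 _]chebTSS -/t !exprS.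
by field.
Qed.
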